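(* Let $\mathbb{F}$ be a field and let $P$ be a one-dimensional Poisson algebra over $\mathbb{F}$ with basis $\{e\}$ (so its Lie bracket is zero) and $e\cdot e=\alpha e$, $\alpha\in\mathbb{F}$. Then the Poisson affgebras $\mathfrak{p}(P;\sigma,s;\mu,\lambda,t)$ are exactly those in the following families. If $\alpha=0$: (1A) $\mathfrak{p}(P;\sigma,0;\mu,\lambda,t)$ with $\sigma=(0,\mathrm{id})$; (1B) $\mathfrak{p}(P;\sigma,0;\mu,\lambda,t)$ with $\sigma=(\mathrm{id},0)$; (1C) $\mathfrak{p}(P;\sigma,s;\mu,\lambda,t)$ with $\sigma=(0,0)$; (1D) $\mathfrak{p}(P;\sigma,s;\mu,\lambda,t)$ with $\sigma=(\mathrm{id},\mathrm{id})$; where $\mu,\lambda$ are arbitrary linear endomorphisms of $P$, $t\in P$ is arbitrary, and in (1C), (1D) $s\in P$ is arbitrary. If $\alpha\neq0$: (1E) $\mathfrak{p}(P;\sigma,s\,e;0,0,t)$ with $\sigma=(\overleftarrow{\sigma},\overleftarrow{\sigma})$, $\overleftarrow{\sigma}(e)=l e$, where $l,s\in\mathbb{F}$ satisfy $l^2-l-s\alpha=0$, and $t\in P$ is arbitrary.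
   Context: **Poisson algebra.** A vector space $P$ over $\mathbb{F}$ with a Lie bracket $[-,-]$ and an associative bilinear product (not assumed commutative or unital) with $[xy,z]=x[y,z]+[x,z]y$ for all $x,y,z$. **Homothetic datum.** A double operator $\sigma=(\overleftarrow{\sigma},\overrightarrow{\sigma})$ on an associative algebra $A$ is a pair of linear endomorphisms, written $a\sigma=\overleftarrow{\sigma}(a)$, $\sigma a=\overrightarrow{\sigma}(a)$. It is a double homothetism if $\sigma(ab)=(\sigma a)b$, $(ab)\sigma=a(b\sigma)$, $a(\sigma b)=(a\sigma)b$ and $\sigma(a\sigma)=(\sigma a)\sigma$ for all $a,b\in A$. A homothetic datum is a pair $(\sigma,s)$ with $\sigma$ a double homothetism and $s\in A$ such that $\sigma s=s\sigma$, $(a\sigma)\sigma=a\sigma+as$ and $\sigma(\sigma a)=\sigma a+sa$ for all $a\in A$. **The Poisson affgebra $\mathfrak{p}(P;\sigma,s;\mu,\lambda,t)$.** It is given by data: a homothetic datum $(\sigma,s)$ on the associative algebra $(P,\cdot)$, an element $t\in P$, and derivations $\lambda,\mu\colon P\to P$ of $(P,\cdot)$ such that $\lambda([a,b])=[\lambda(a),b]-[a,\mu(b)]$ for all $a,b\in P$. It is the vector space $P$ viewed as an affine space, with associative bi-affine product $a\bullet b=ab+a\sigma+\sigma b+s$ and affine Poisson bracket $\{a,b\}=[a,b]+\mu(a)+\lambda(b)+t$. (Every Poisson affgebra is of this form for $P$ any of its fibres.) *)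

(* Defs.v *)
From HB Require Import structures.
From mathcomp Require Import all_boot all_order all_algebra.
Set Implicit Arguments.
Unset Strict Implicit.
Unset Printing Implicit Defensive.
Import GRing.Theory.
Local Open Scope ring_scope.

(* The associative product is neither commutative nor unital in general, so
   the unital ring and algebra structures of ssralg do not apply. *)
Record poissonAlg (F : fieldType) (P : vectType F) := PoissonAlg {
  pmul : {bilinear P -> P -> P};
  plie : {bilinear P -> P -> P};
  pmulA : forall x y z, pmul x (pmul y z) = pmul (pmul x y) z;
  plie_alt : forall x, plie x x = 0;
  plie_jacobi : forall x y z,
    plie x (plie y z) + plie y (plie z x) + plie z (plie x y) = 0;
  plie_leibniz : forall x y z,
    plie (pmul x y) z = pmul x (plie y z) + pmul (plie x z) y
}.

(* The first component is the left-arrow map a |-> a sigma, the second one is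
   the right-arrow map a |-> sigma a. *)
Definition doubleOp (F : fieldType) (P : vectType F) : Type :=
  ('End(P) * 'End(P))%type.

Definition rop (F : fieldType) (P : vectType F) (sigma : doubleOp P) (a : P) : P :=
  sigma.1 a.

Definition lop (F : fieldType) (P : vectType F) (sigma : doubleOp P) (a : P) : P :=
  sigma.2 a.

Notation "a *< sigma" := (rop sigma a)
  (at level 40, left associativity) : ring_scope.
Notation "sigma >* a" := (lop sigma a)
  (at level 40, left associativity) : ring_scope.

Definition double_homothetism (F : fieldType) (P : vectType F)
    (M : poissonAlg P) (sigma : doubleOp P) : Prop :=
  [/\ forall a b, sigma >* pmul M a b = pmul M (sigma >* a) b,
      forall a b, pmul M a b *< sigma = pmul M a (b *< sigma),
      forall a b, pmul M a (sigma >* b) = pmul M (a *< sigma) b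
    & forall a, sigma >* (a *< sigma) = (sigma >* a) *< sigma].

Definition homothetic_datum (F : fieldType) (P : vectType F)
    (M : poissonAlg P) (sigma : doubleOp P) (s : P) : Prop :=
  [/\ double_homothetism M sigma,
      sigma >* s = s *< sigma,
      forall a, (a *< sigma) *< sigma = a *< sigma + pmul M a s
    & forall a, sigma >* (sigma >* a) = sigma >* a + pmul M s a].

Definition derivation (F : fieldType) (P : vectType F)
    (M : poissonAlg P) (d : 'End(P)) : Prop :=
  forall a b, d (pmul M a b) = pmul M (d a) b + pmul M a (d b).

(* The parameters (sigma, s; mu, lambda, t). *)
Record affData (F : fieldType) (P : vectType F) := AffData {
  dop : doubleOp P;
  ds : P;
  dmu : 'End(P);
  dlambda : 'End(P);
  dt : P
}.

Definition poisson_affData (F : fieldType) (P : vectType F)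
    (M : poissonAlg P) (D : affData P) : Prop :=
  [/\ homothetic_datum M (dop D) (ds D),
      derivation M (dlambda D),
      derivation M (dmu D)
    & forall a b, dlambda D (plie M a b) =
                  plie M (dlambda D a) b - plie M a (dmu D b)].

(* A product and a bracket on the affine space underlying P. *)
Record affOps (F : fieldType) (P : vectType F) := AffOps {
  amul : P -> P -> P;
  abr : P -> P -> P
}.

(* The affgebra p(P; sigma, s; mu, lambda, t); it is a Poisson affgebra when
   poisson_affData M D holds. *)
Definition paff (F : fieldType) (P : vectType F)
    (M : poissonAlg P) (D : affData P) : affOps P :=
  AffOps
    (fun a b => pmul M a b + a *< dop D + dop D >* b + ds D)
    (fun a b => plie M a b + dmu D a + dlambda D b + dt D).

Definition is_poisson_affgebra (F : fieldType) (P : vectType F)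
    (M : poissonAlg P) (X : affOps P) : Prop :=
  exists2 D : affData P, poisson_affData M D & X = paff M D.

Definition family1A (F : fieldType) (P : vectType F)
    (D : affData P) : Prop :=
  exists mu lambda t, D = AffData (0, \1%VF) 0 mu lambda t.

Definition family1B (F : fieldType) (P : vectType F)
    (D : affData P) : Prop :=
  exists mu lambda t, D = AffData (\1%VF, 0) 0 mu lambda t.

Definition family1C (F : fieldType) (P : vectType F)
    (D : affData P) : Prop :=
  exists s mu lambda t, D = AffData (0, 0) s mu lambda t.

Definition family1D (F : fieldType) (P : vectType F)
    (D : affData P) : Prop :=
  exists s mu lambda t, D = AffData (\1%VF, \1%VF) s mu lambda t.

Definition family1E (F : fieldType) (P : vectType F)
    (e : P) (alpha : F) (D : affData P) : Prop :=
  exists (sl : 'End(P)) (l s : F) (t : P),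
    [/\ sl e = l *: e,
        l ^+ 2 - l - s * alpha = 0
      & D = AffData (sl, sl) (s *: e) 0 0 t].

(* Main.v *)
Require Import Defs.
From HB Require Import structures.
From mathcomp Require Import all_boot all_order all_algebra.
Set Implicit Arguments.
Unset Strict Implicit.
Unset Printing Implicit Defensive.
Import GRing.Theory.
Local Open Scope ring_scope.

(** On a line every endomorphism is a homothety, so a datum amounts to
    scalars: [a *< sigma = l *: a], [sigma >* a = r *: a] and [s = c *: e].
    If [alpha = 0] the product vanishes and only [l ^+ 2 = l], [r ^+ 2 = r]
    and [(l - r) * c = 0] remain, so [l] and [r] are [0] or [1].  If
    [alpha != 0] then [e (sigma e) = (e sigma) e] forces [l = r], the
    homothetic condition becomes [l ^+ 2 = l + c * alpha], and a derivation
    [d e = k *: e] satisfies [k = k + k], hence vanishes. *)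

Section Line.

Variables (F : fieldType) (P : vectType F) (e : P).
Hypothesis e_basis : basis_of fullv [:: e].

Lemma basis1_neq0 : e != 0.
Proof. by rewrite -seq1_free; case/andP: e_basis. Qed.

Lemma basis1_coord (v : P) : exists c, v = c *: e.
Proof.
apply/vlineP; rewrite -span_seq1.
by case/andP: e_basis => /eqP -> _; rewrite memvf.
Qed.

(** Used to turn equations between multiples of [e] into equations between scalars. *)
Lemma basis1_scale_inj : injective (fun c : F => c *: e).
Proof.
move=> a b /eqP; rewrite -subr_eq0 -scalerBl scaler_eq0.
by rewrite (negPf basis1_neq0) orbF subr_eq0 => /eqP.
Qed.

Lemma basis1_endo_scale (f : 'End(P)) (k : F) :
  f e = k *: e -> forall v, f v = k *: v.
Proof.
move=> fe v; have [c ->] := basis1_coord v.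
by rewrite linearZ /= fe scalerA mulrC -scalerA.
Qed.

Lemma basis1_endoP (f : 'End(P)) : exists k, forall v, f v = k *: v.
Proof. by have [k /basis1_endo_scale fk] := basis1_coord (f e); exists k. Qed.

Variable M : poissonAlg P.

(** By bilinearity every bracket is a multiple of [plie M e e], which vanishes by alternation. *)
Lemma basis1_plie0 (a b : P) : plie M a b = 0.
Proof.
have [[x ->] [y ->]] := (basis1_coord a, basis1_coord b).
by rewrite linearZl_LR linearZr_LR /= plie_alt !scaler0.
Qed.

Variable alpha : F.
Hypothesis mul_ee : pmul M e e = alpha *: e.

Lemma basis1_pmul (x y : F) :
  pmul M (x *: e) (y *: e) = (x * y * alpha) *: e.
Proof. by rewrite linearZl_LR linearZr_LR /= mul_ee !scalerA. Qed.

Lemma basis1_pmul0 : alpha = 0 -> forall a b, pmul M a b = 0.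
Proof.
move=> alpha0 a b; have [[x ->] [y ->]] := (basis1_coord a, basis1_coord b).
by rewrite basis1_pmul alpha0 mulr0 scale0r.
Qed.

Lemma basis1_derivation0 (d : 'End(P)) :
  alpha != 0 -> derivation M d -> d = 0.
Proof.
move=> alpha0 der_d; have [k dk] := basis1_endoP d.
have /esym/eqP := der_d e e; rewrite !dk linearZl_LR linearZr_LR /= mul_ee.
(* Cancelling one copy of [k *: (alpha *: e)] on each side leaves that vector equal to [0], in every
   characteristic. *)
rewrite -[eqbRHS]add0r (inj_eq (addIr _)) !scaler_eq0.
rewrite (negPf basis1_neq0) (negPf alpha0) !orbF => /eqP k0.
by apply/lfunP => v; rewrite dk k0 scale0r zero_lfunE.
Qed.

Lemma poisson_affData_basis1_null (D : affData P) :
  alpha = 0 ->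
  poisson_affData M D <-> [\/ family1A D, family1B D, family1C D | family1D D].
Proof.
move=> alpha0; have mul0 := basis1_pmul0 alpha0.
have der0 (d : 'End(P)) : derivation M d.
  by move=> a b; rewrite !mul0 linear0 addr0.
split; last first.
  (* Product and bracket both vanish, so the derivation and compatibility conditions hold for all
     [mu] and [lambda]. *)
  have suffD D' : homothetic_datum M (dop D') (ds D') -> poisson_affData M D'.
    by split=> // a b; rewrite !basis1_plie0 linear0 subr0.
  case=> [[mu [la [t ->]]]|[mu [la [t ->]]]|[s [mu [la [t ->]]]]
         |[s [mu [la [t ->]]]]]; apply: suffD; split=> [|||] /=;
    first [split=> * | move=> *];
    by rewrite /rop /lop /= ?mul0 ?id_lfunE ?zero_lfunE ?addr0 ?linear0.
case: D => -[sl sr] s mu la t [[_ /= comm_s idem_l idem_r] _ _ _].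
(* The summand [0] is the value of the correction terms [pmul M a s] and [pmul M s a]. The scalar of
   [f] is then a root of [k * (k - 1)]. *)
have idem_scale (f : 'End(P)) :
    (forall a, f (f a) = f a + 0) -> f = 0 \/ f = \1%VF.
  have [k fk] := basis1_endoP f => /(_ e) /eqP.
  rewrite addr0 !fk scalerA (inj_eq basis1_scale_inj) => /eqP kk.
  have /eqP : k * (k - 1) = 0 by rewrite mulrBr mulr1 kk subrr.
  rewrite mulf_eq0 subr_eq0 => /orP[]/eqP k01; [left|right];
    by apply/lfunP => v; rewrite fk k01 ?scale0r ?scale1r ?zero_lfunE ?id_lfunE.
have [|sl_eq|sl_eq] := idem_scale sl;
  first by move=> a; rewrite -(mul0 a s); apply: idem_l.
  have [|sr_eq|sr_eq] := idem_scale sr;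
    first by move=> a; rewrite -(mul0 s a); apply: idem_r.
    by constructor 3; exists s, mu, la, t; rewrite sl_eq sr_eq.
  (* When one operator is zero and the other the identity, [sigma >* s = s *< sigma] forces
     [s = 0]. *)
  move: comm_s; rewrite /rop /lop /= sl_eq sr_eq id_lfunE zero_lfunE => ->.
  by constructor 1; exists mu, la, t.
have [|sr_eq|sr_eq] := idem_scale sr;
  first by move=> a; rewrite -(mul0 s a); apply: idem_r.
  move: comm_s; rewrite /rop /lop /= sl_eq sr_eq id_lfunE zero_lfunE => <-.
  by constructor 2; exists mu, la, t.
by constructor 4; exists s, mu, la, t; rewrite sl_eq sr_eq.
Qed.

Lemma poisson_affData_basis1_unital (D : affData P) :
  alpha != 0 -> poisson_affData M D <-> family1E e alpha D.
Proof.
move=> alpha0; split.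
  case: D => -[sl sr] s mu la t [[[_ _ /= mid _] _ /= idem_l _] der_la der_mu _].
  rewrite (basis1_derivation0 alpha0 der_la) (basis1_derivation0 alpha0 der_mu).
  have [[l slE] [r srE]] := (basis1_endoP sl, basis1_endoP sr).
  have [c s_eq] := basis1_coord s; subst s.
  have rl : r = l.
    have /eqP := mid e e; rewrite /lop /rop /= slE srE linearZl_LR linearZr_LR.
    rewrite /= mul_ee !scalerA (inj_eq basis1_scale_inj).
    by rewrite (inj_eq (mulIf alpha0)) => /eqP.
  exists sl, l, c, t; split=> //.
    have /eqP := idem_l e; rewrite /rop /= !slE linearZr_LR /= mul_ee !scalerA.
    rewrite -scalerDl (inj_eq basis1_scale_inj) => /eqP ll.
    by rewrite expr2 ll -addrA -opprD subrr.
  suff -> : sr = sl by [].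
  by apply/lfunP => v; rewrite srE slE rl.
case=> sl [l [c [t [/basis1_endo_scale slE lE ->]]]].
(* On [x *: e] both quadratic conditions of a homothetic datum become this identity multiplied by
   [x]. *)
have ll : l * l = l + c * alpha.
  by apply/eqP; rewrite -subr_eq0 opprD addrA -expr2 lE.
have der0 : derivation M (0 : 'End(P)).
  by move=> a b; rewrite !zero_lfunE linear0l linear0r addr0.
split=> //=; last by move=> a b; rewrite !basis1_plie0 linear0 subr0.
split=> //=; rewrite /rop /lop /=.
(* Both operators are the same homothety, and bilinearity moves its scalar freely through
   products. *)
- by split=> *; rewrite /rop /lop /= !slE ?linearZl_LR ?linearZr_LR.
- move=> a; have [x ->] := basis1_coord a.
  by rewrite !slE basis1_pmul !scalerA -scalerDl ll mulrDl (mulrC x c) (mulrAC c).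
- move=> a; have [x ->] := basis1_coord a.
  by rewrite !slE basis1_pmul !scalerA -scalerDl ll mulrDl (mulrAC c).
Qed.

End Line.

(** Affgebras are the image of the valid data under [paff M], so a description of those data passes
    to the operations without appeal to injectivity of [paff M]. *)
Lemma is_poisson_affgebra_iff (F : fieldType) (P : vectType F)
    (M : poissonAlg P) (Q : affData P -> Prop) :
  (forall D, poisson_affData M D <-> Q D) ->
  forall X, is_poisson_affgebra M X <-> exists2 D, Q D & X = paff M D.
Proof. by move=> PQ X; split=> -[D /PQ QD ->]; exists D. Qed.

Theorem mainTheorem5 (F : fieldType) (P : vectType F) (M : poissonAlg P)
    (e : P) (alpha : F)
    (e_basis : basis_of fullv [:: e])
    (mul_ee : pmul M e e = alpha *: e) :
  [/\ forall a b : P, plie M a b = 0,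
      alpha = 0 ->
        (forall D : affData P,
           poisson_affData M D <->
           [\/ family1A D, family1B D, family1C D | family1D D]) /\
        (forall X : affOps P,
           is_poisson_affgebra M X <->
           exists2 D : affData P,
             [\/ family1A D, family1B D, family1C D | family1D D]
             & X = paff M D)
    & alpha != 0 ->
        (forall D : affData P,
           poisson_affData M D <-> family1E e alpha D) /\
        (forall X : affOps P,
           is_poisson_affgebra M X <->
           exists2 D : affData P, family1E e alpha D & X = paff M D)].
Proof.
split=> [|alpha0|alpha0]; first exact: (basis1_plie0 e_basis).
  have dataP D := poisson_affData_basis1_null e_basis mul_ee D alpha0.
  by split; [exact: dataP | exact: is_poisson_affgebra_iff dataP].
have dataP D := poisson_affData_basis1_unital e_basis mul_ee D alpha0.
by split; [exact: dataP | exact: is_poisson_affgebra_iff dataP].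
Qed.
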